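(* Let $S=(\mathcal B;R,E)$ be a linear rewriting system modulo. If $S^+$ is convergent modulo $E$, then the canonical linear map $$\mathrm{NF}_S/\langle E\rangle_\Bbbk\to\langle\mathcal B\rangle_\Bbbk/\langle R\sqcup E\rangle_\Bbbk$$ is an isomorphism. In particular, if $B\subset\mathcal B\mathrm{NF}_S$ is such that its image in $\mathrm{NF}_S/\langle E\rangle_\Bbbk$ is a basis of this module, then its image in $\langle\mathcal B\rangle_\Bbbk/\langle R\sqcup E\rangle_\Bbbk$ is a basis of the module presented by $S$.
   Context: $\Bbbk$ is a commutative ring with group of units $\Bbbk^\times$, $\mathcal B$ is a set whose elements are called monomials, $\langle\mathcal B\rangle_\Bbbk$ is the free $\Bbbk$-module on $\mathcal B$, and $\mathrm{supp}(v)\subset\mathcal B$ is the support of a vector $v$. A linear 1-polygraph on $\mathcal B$ is a set of relations $r$, each with a source $s(r)$ and target $t(r)$ in $\langle\mathcal B\rangle_\Bbbk$. A linear rewriting system modulo $S=(\mathcal B;R,E)$ consists of two linear 1-polygraphs $R,E$ on $\mathcal B$ such that: - $E$ is monomial-invertible: for each $e\in E$, $s(e)\in\mathcal B$ and $t(e)=\lambda b'$ with $\lambda\in\Bbbk^\times$, $b'\in\mathcal B$; - $R$ is $E$-adapted: for each $r\in R$, $s(r)\in\mathcal B$ and $s(r)\notin\mathrm{projsupp}_E(t(r))$. Here $u\sim_E v$ ($E$-congruence) means that $u-v$ lies in the submodule spanned by the $s(e)-t(e)$, $e\in E$. Monomials $b,b'$ are projectively $E$-congruent if $b\sim_E\lambda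 b'$ for some $\lambda\in\Bbbk^\times$, and $\mathrm{projsupp}_E(v)$ is the set of monomials projectively $E$-congruent to some element of $\mathrm{supp}(v)$. $\langle\mathcal B\rangle_\Bbbk/\langle R\sqcup E\rangle_\Bbbk$, the module presented by $S$, denotes the quotient of $\langle\mathcal B\rangle_\Bbbk$ by the submodule spanned by the $s(r)-t(r)$, $r\in R\sqcup E$. An $S$-rewriting step is a composite $u\sim_E\lambda s(r)+v\dashrightarrow\lambda t(r)+v\sim_E w$ with $\lambda\in\Bbbk\setminus\{0\}$, $r\in R$, $v\in\langle\mathcal B\rangle_\Bbbk$; it is positive if $s(r)\notin\mathrm{projsupp}_E(v)$. $S^+$ denotes the set of positive steps. A positive rewriting sequence is either an $E$-congruence or a finite composite of positive steps. $S^+$ is confluent if for any two positive rewriting sequences with the same source $u$ and targets $v,v'$, there are positive rewriting sequences from $v$ and from $v'$ to a common target; it is terminating modulo $E$ if there is no infinite sequence of composable positive steps; it is convergent modulo $E$ if it is both. A monomial $S$-normal form is a monomial $b$ which is not projectively $E$-congruent to $s(r)$ for any $r\in R$; their set is $\mathcal B\mathrm{NF}_S$, and $\mathrm{NF}_S=\langle\mathcal B\mathrm{NF}_S\rangle_\Bbbk$ is the module of normal forms. $\mathrm{NF}_S/\langle E\rangle_\Bbbk$ is the quotient of $\mathrm{NF}_S$ by the submodule spanned by $s(e)-t(e)$ for those $e\in E$ with $s(e)\in\mathcal B\mathrm{NF}_S$ (then $t(e)\in\mathrm{NF}_S$). *)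

(* Defs.v *)
From HB Require Import structures.
From mathcomp Require Import all_boot all_algebra finmap monalg.
From mathcomp Require Import boolp classical_sets.
From Stdlib Require Import Relation_Operators.

Set Implicit Arguments.
Unset Strict Implicit.
Unset Printing Implicit Defensive.

Import GRing.Theory.
Local Open Scope classical_set_scope.
Local Open Scope ring_scope.
Local Open Scope quotient_scope.

(* [{malg k[B]}] is a module only when [k] is nontrivial; the scaling is
   redefined on an alias so that the zero ring is allowed as well. *)
Definition freemod (k : comPzRingType) (B : choiceType) : Type := {malg k[B]}.

Section FreeModule.
Variables (k : comPzRingType) (B : choiceType).
Implicit Types (c : k) (u v : freemod k B).

HB.instance Definition _ := GRing.Zmodule.copy (freemod k B) {malg k[B]}.

Definition freemod_scale c u : freemod k B :=
  [malg b in msupp u => c * u@_b].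

Lemma freemod_scaleE c u b : (freemod_scale c u)@_b = c * u@_b.
Proof. by rewrite mcoeffE; case: msuppP; rewrite ?mulr0. Qed.

Fact freemod_scaleA c1 c2 u :
  freemod_scale c1 (freemod_scale c2 u) = freemod_scale (c1 * c2) u.
Proof. by apply/malgP => b; rewrite !freemod_scaleE mulrA. Qed.

Fact freemod_scale1 : left_id 1 freemod_scale.
Proof. by move=> u; apply/malgP => b; rewrite freemod_scaleE mul1r. Qed.

Fact freemod_scaleDr : right_distributive freemod_scale +%R.
Proof.
move=> c u v; apply/malgP => b.
by rewrite !(freemod_scaleE, mcoeffD) mulrDr.
Qed.

Fact freemod_scaleDl u : {morph freemod_scale^~ u : c1 c2 / c1 + c2}.
Proof.
move=> c1 c2; apply/malgP => b.
by rewrite !(freemod_scaleE, mcoeffD) mulrDl.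
Qed.

HB.instance Definition _ := GRing.Zmodule_isLmodule.Build k (freemod k B)
  freemod_scaleA freemod_scale1 freemod_scaleDr freemod_scaleDl.

Lemma freemodZ c u b : (c *: u)@_b = c * u@_b.
Proof. exact: freemod_scaleE. Qed.

Definition mono (b : B) : freemod k B := << b >>.

End FreeModule.

Section Span.
Variables (k : pzRingType) (V : lmodType k).
Implicit Types (A : set V).

Definition lspan A : {pred V} :=
  fun v => `[< exists n (c : 'I_n -> k) (a : 'I_n -> V),
                 (forall i, A (a i)) /\ v = \sum_(i < n) c i *: a i >].

Fact lspan_submod_closed A : submod_closed (lspan A).
Proof.
split.
  apply/asboolP; exists 0%N, (fun=> 0), (fun=> 0).
  by split=> [[]//|]; rewrite big_ord0.
move=> d u v /asboolP[n [c [a [aA ->]]]] /asboolP[m [e [b [bA ->]]]].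
apply/asboolP; exists (n + m)%N.
exists (fun i => match split i with inl j => d * c j | inr j => e j end).
exists (fun i => match split i with inl j => a j | inr j => b j end).
split=> [i|]; first by case: (split i).
rewrite big_split_ord scaler_sumr /=; congr (_ + _).
  by apply: eq_bigr => i _; rewrite (unsplitK (inl _ i)) scalerA.
by apply: eq_bigr => i _; rewrite (unsplitK (inr _ i)).
Qed.

HB.instance Definition _ A :=
  GRing.isSubmodClosed.Build k V (lspan A) (lspan_submod_closed A).

Lemma sub_lspan A v : A v -> v \in lspan A.
Proof.
move=> Av; apply/asboolP; exists 1%N, (fun=> 1), (fun=> v).
by split=> //; rewrite big_ord1 scale1r.
Qed.

(* The quotient of [V] by the submodule spanned by [A]. *)
Definition quotmod A : Type := (Quotient.quot (lspan A)).

HB.instance Definition _ A := Choice.on (quotmod A).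
HB.instance Definition _ A := GRing.Zmodule.on (quotmod A).
HB.instance Definition _ A := Quotient.on (quotmod A).

Definition quot_pi A (v : V) : quotmod A := \pi_(quotmod A) v.

Lemma quot_piP A u v : quot_pi A u = quot_pi A v <-> u - v \in lspan A.
Proof. by rewrite Quotient.idealrBE; split=> [/eqP|/eqP]. Qed.

Definition quot_scale A c (x : quotmod A) : quotmod A := quot_pi A (c *: repr x).

Lemma quot_piK A (x : quotmod A) : quot_pi A (repr x) = x.
Proof. exact: reprK. Qed.

Lemma repr_quot_pi A v : repr (quot_pi A v) - v \in lspan A.
Proof. by apply/quot_piP; rewrite quot_piK. Qed.

Lemma quot_piB A : zmod_morphism (quot_pi A).
Proof. by move=> u v; rewrite /quot_pi; exact: (raddfB (\pi_(Quotient.quot (lspan A)))). Qed.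

HB.instance Definition _ A :=
  GRing.isZmodMorphism.Build V (quotmod A) (quot_pi A) (@quot_piB A).

Lemma quot_scale_pi A c v : quot_scale c (quot_pi A v) = quot_pi A (c *: v).
Proof. by apply/quot_piP; rewrite -scalerBr rpredZ// repr_quot_pi. Qed.

Fact quot_scaleA A c d (x : quotmod A) :
  quot_scale c (quot_scale d x) = quot_scale (c * d) x.
Proof. by rewrite -[x]quot_piK !quot_scale_pi scalerA. Qed.

Fact quot_scale1 A : left_id 1 (@quot_scale A).
Proof. by move=> x; rewrite -[x]quot_piK quot_scale_pi scale1r. Qed.

Fact quot_scaleDr A : right_distributive (@quot_scale A) +%R.
Proof.
move=> c x y; rewrite -[x]quot_piK -[y]quot_piK -raddfD !quot_scale_pi.
by rewrite -raddfD -scalerDr.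
Qed.

Fact quot_scaleDl A (x : quotmod A) :
  {morph (@quot_scale A)^~ x : c d / c + d}.
Proof.
by move=> c d; rewrite -[x]quot_piK !quot_scale_pi -raddfD -scalerDl.
Qed.

HB.instance Definition _ A := GRing.Zmodule_isLmodule.Build k (quotmod A)
  (@quot_scaleA A) (@quot_scale1 A) (@quot_scaleDr A) (@quot_scaleDl A).

Lemma quot_piZ A : scalable (quot_pi A).
Proof. by move=> c v; rewrite -[LHS]quot_scale_pi. Qed.

HB.instance Definition _ A :=
  GRing.isScalable.Build k V (quotmod A) *:%R (quot_pi A) (@quot_piZ A).

Definition lin_indep (X : set V) : Prop :=
  forall (s : seq V) (c : V -> k), uniq s -> (forall x, x \in s -> X x) ->
    \sum_(x <- s) c x *: x = 0 -> forall x, x \in s -> c x = 0.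

(* Bases are subsets, not families: distinct monomials with the same image
   contribute a single vector. *)
Definition is_basis (X : set V) : Prop :=
  lin_indep X /\ forall v, v \in lspan X.

End Span.

Section LinearRewriting.
Variables (k : comPzRingType) (B : choiceType).
Implicit Types (u v w : freemod k B) (b : B).

Record polygraph1 := Polygraph1 {
  rel1 : Type;
  src : rel1 -> freemod k B;
  tgt : rel1 -> freemod k B
}.

Definition relset (P : polygraph1) : set (freemod k B) :=
  [set src r - tgt r | r in @setT (rel1 P)].

Definition polygraph1_sum (P Q : polygraph1) : polygraph1 :=
  {| rel1 := (rel1 P + rel1 Q)%type;
     src := fun r => match r with inl p => src p | inr q => src q end;
     tgt := fun r => match r with inl p => tgt p | inr q => tgt q end |}.

Definition presented_by (P : polygraph1) : lmodType k := quotmod (relset P).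

Definition is_unit (c : k) : Prop := exists d, c * d = 1.

Definition E_congr (E : polygraph1) u v : Prop := u - v \in lspan (relset E).

Definition proj_congr (E : polygraph1) b b' : Prop :=
  exists2 c, is_unit c & E_congr E (mono k b) (c *: mono k b').

Definition projsupp (E : polygraph1) v : set B :=
  [set b | exists2 b', b' \in msupp v & proj_congr E b b'].

Definition monomial_invertible (E : polygraph1) : Prop :=
  forall e : rel1 E, (exists b, src e = mono k b) /\
    (exists c b', is_unit c /\ tgt e = c *: mono k b').

Definition adapted (E R : polygraph1) : Prop :=
  forall r : rel1 R, (exists b, src r = mono k b) /\
    ~ (@mono k B @` projsupp E (tgt r)) (src r).

Record lrsm := LRSM {
  lrsR : polygraph1;
  lrsE : polygraph1;
  lrsE_invertible : monomial_invertible lrsE;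
  lrsR_adapted : adapted lrsE lrsR
}.

Section System.
Variable S : lrsm.
Local Notation R := (lrsR S).
Local Notation E := (lrsE S).

Definition rew_step (r : rel1 R) (c : k) v u w : Prop :=
  [/\ c != 0, E_congr E u (c *: src r + v) & E_congr E (c *: tgt r + v) w].

Definition positive (r : rel1 R) v : Prop :=
  ~ (@mono k B @` projsupp E v) (src r).

Definition pos_step u w : Prop :=
  exists r c v, rew_step r c v u w /\ positive r v.

Definition pos_seq u w : Prop := E_congr E u w \/ clos_trans _ pos_step u w.

Definition pos_confluent : Prop :=
  forall u v v', pos_seq u v -> pos_seq u v' ->
    exists2 w, pos_seq v w & pos_seq v' w.

Definition pos_terminating : Prop :=
  ~ exists f : nat -> freemod k B, forall n, pos_step (f n) (f n.+1).

Definition pos_convergent : Prop := pos_confluent /\ pos_terminating.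

Definition BNF : set B :=
  [set b | forall (r : rel1 R) b', src r = mono k b' -> ~ proj_congr E b b'].

(* The free module on [BNF], realized as the submodule of vectors supported
   in [BNF]. *)
Definition nfpred : {pred freemod k B} :=
  fun u => `[< forall b, b \in msupp u -> BNF b >].

Fact nfpred_submod_closed : submod_closed nfpred.
Proof.
split; first by apply/asboolP => b; rewrite msupp0.
move=> c u v /asboolP uN /asboolP vN; apply/asboolP => b.
rewrite -mcoeff_neq0 mcoeffD freemodZ => h.
case: (msuppP u b) (uN b) h => [_ + _|_ _]; first exact.
by rewrite mulr0 add0r mcoeff_neq0 => /vN.
Qed.

HB.instance Definition _ :=
  GRing.isSubmodClosed.Build k (freemod k B) nfpred nfpred_submod_closed.

Record NF : predArgType := MkNF { nfval : freemod k B; _ : nfval \in nfpred }.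

HB.instance Definition _ := [isSub for nfval].
HB.instance Definition _ := [Choice of NF by <:].
HB.instance Definition _ := [SubChoice_isSubLmodule of NF by <:].

(* By [E_rel_nf] below, no [src e - tgt e] is lost by asking it to lie in NF. *)
Definition nf_relset : set NF :=
  [set x | exists2 e : rel1 E,
     (@mono k B @` BNF) (src e) & val x = src e - tgt e].

Lemma E_rel_nf (e : rel1 E) :
  (@mono k B @` BNF) (src e) -> src e - tgt e \in nfpred.
Proof.
move=> [b bN eb]; have [_ [c [b' [[d cd] te]]]] := lrsE_invertible e.
have ebb' : E_congr E (mono k b) (c *: mono k b').
  by apply: sub_lspan; exists e; rewrite // -eb te.
rewrite te.
apply/asboolP => b1.
rewrite -mcoeff_neq0 mcoeffB freemodZ -eb /mono !mcoeffU.
have [<-//|_] := eqVneq b b1; have [<- _|_] := eqVneq b' b1; last first.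
  by rewrite mulr0 subrr eqxx.
move=> r b2 rb2 [c' [d' cd'] h]; apply: (bN r b2 rb2); exists (c * c').
  by exists (d * d'); rewrite mulrACA cd cd' mulr1.
rewrite /E_congr -(subrKA (c *: mono k b')) rpredD//.
by rewrite -scalerA -scalerBr rpredZ.
Qed.

Definition presented : lmodType k := presented_by (polygraph1_sum R E).

Definition NFmodE : lmodType k := quotmod nf_relset.

Definition nf_pi (u : NF) : NFmodE := quot_pi nf_relset u.

Definition presented_pi (u : freemod k B) : presented :=
  quot_pi (relset (polygraph1_sum R E)) u.

(* The map induced by the inclusion of NF, see [nf_canon_pi]. *)
Definition nf_canon (x : NFmodE) : presented := presented_pi (val (repr x)).

Lemma nf_canon_pi (u : NF) : nf_canon (nf_pi u) = presented_pi (val u).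
Proof.
apply/quot_piP; rewrite -raddfB.
have /asboolP[n [c [a [aP ->]]]] := repr_quot_pi nf_relset u.
rewrite raddf_sum rpred_sum// => i _ /=; rewrite rpredZ//.
have [e _ ->] := aP i; apply: sub_lspan.
by exists (inr e).
Qed.

Fact nf_canon_is_linear : linear nf_canon.
Proof.
move=> c x y; rewrite -[x]quot_piK -[y]quot_piK -linearP.
by rewrite !nf_canon_pi /presented_pi !linearP.
Qed.

HB.instance Definition _ :=
  GRing.isLinear.Build k NFmodE presented *:%R nf_canon nf_canon_is_linear.

End System.
End LinearRewriting.

(* Main.v *)
(** The map sending a vector to its normal form is never shown to be linear.
  For every [c] and [v], grouping the monomials of [v] that are projectively
  E-congruent to [src r] shows that [c *: src r + v] and [c *: tgt r + v] have a
  common positive reduct; hence vectors with the same class in the presented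
  module have E-congruent normal forms. A vector of NF admits no positive step,
  because termination forces [c *: src r] to be E-congruent to 0 only for
  [c = 0]. Both this and the passage from the span of E to its part inside NF
  use that restricting vectors to a union of projective E-classes of monomials
  preserves E-congruence. *)
Require Import Defs.
From HB Require Import structures.
From mathcomp Require Import all_boot all_algebra finmap monalg.
From mathcomp Require Import boolp classical_sets.
From Stdlib Require Import Relation_Operators.

Set Implicit Arguments.
Unset Strict Implicit.
Unset Printing Implicit Defensive.

Import GRing.Theory.
Local Open Scope classical_set_scope.
Local Open Scope ring_scope.

(** * Linear images of spans and bases *)

Section Span.
Variable k : pzRingType.

Lemma lspan_image (V W : lmodType k) (f : {linear V -> W}) (A : set V)
    (A' : set W) :
  (forall a, A a -> f a \in lspan A') ->
  forall v, v \in lspan A -> f v \in lspan A'.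
Proof.
move=> fA v /asboolP[n [c [a [aA ->]]]].
rewrite linear_sum rpred_sum// => i _.
by rewrite linearZ rpredZ// fA.
Qed.

Lemma is_basis_image (V W : lmodType k) (f : {linear V -> W}) (X : set V) :
  bijective f -> is_basis X -> is_basis (f @` X).
Proof.
move=> [g fK gK] [Xfree Xgen]; split.
  move=> s c us sX s0 x xs.
  have gX y : y \in map g s -> X y.
    by move=> /mapP[z zs ->]; have [y' Xy' <-] := sX z zs; rewrite fK.
  (* Coefficients are functions on vectors, so a dependence pulled back along [g] takes its
     coefficients through [f]. *)
  have := Xfree (map g s) (c \o f) _ gX _ (g x).
  rewrite /= gK; apply; last exact: map_f.
    by rewrite map_inj_uniq//; exact: can_inj gK.
  apply: (can_inj fK); rewrite linear0 linear_sum -[RHS]s0 big_map.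
  by apply: eq_bigr => i _ /=; rewrite linearZ /= !gK.
move=> w; rewrite -[w]gK; apply: (@lspan_image _ _ f X) (Xgen _).
by move=> a Xa; apply: sub_lspan; exists a.
Qed.

End Span.

(** * Restricting vectors to a set of monomials *)

Section Restriction.
Variables (k : comPzRingType) (B : choiceType).
Implicit Types (u v w : freemod k B) (b : B) (P : set B).

Lemma mcoeff_mono b b' : (mono k b)@_b' = (b == b')%:R.
Proof. by rewrite /mono mcoeffU. Qed.

Lemma freemod_sumE u : u = \sum_(b <- msupp u) u@_b *: mono k b.
Proof.
rewrite {1}[u]monalgE; apply: eq_bigr => b _.
by apply/malgP => b'; rewrite freemodZ mcoeff_mono mcoeffU mulr_natr.
Qed.

Definition restr P u : freemod k B :=
  [malg b in msupp u => if `[< P b >] then u@_b else 0].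

Lemma restrE P u b : (restr P u)@_b = if `[< P b >] then u@_b else 0.
Proof. by rewrite mcoeffE; case: msuppP => // _; case: ifP. Qed.

Fact restr_is_linear P : linear (restr P).
Proof.
move=> c u v; apply/malgP => b.
rewrite mcoeffD freemodZ !restrE mcoeffD freemodZ.
by case: ifP; rewrite // mulr0 addr0.
Qed.

HB.instance Definition _ P := GRing.isLinear.Build k (freemod k B)
  (freemod k B) *:%R (restr P) (restr_is_linear P).

Lemma restr_id P u : (forall b, ~ P b -> u@_b = 0) -> restr P u = u.
Proof.
move=> u0; apply/malgP => b; rewrite restrE.
by case: ifPn => // /asboolPn /u0.
Qed.

Lemma restr_eq0 P u : (forall b, P b -> u@_b = 0) -> restr P u = 0.
Proof.
move=> u0; apply/malgP => b; rewrite restrE mcoeff0.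
by case: ifPn => // /asboolP /u0.
Qed.

Lemma restr_mono P b : restr P (mono k b) = if `[< P b >] then mono k b else 0.
Proof.
case: ifPn => [/asboolP Pb|/asboolPn Pb].
  by apply: restr_id => b'; rewrite mcoeff_mono; case: eqP => // <-.
by apply: restr_eq0 => b'; rewrite mcoeff_mono; case: eqP => // <-.
Qed.

Lemma restr_split P u : u = restr P u + restr (~` P) u.
Proof.
apply/malgP => b; rewrite mcoeffD !restrE asbool_neg.
by case: `[< P b >]; rewrite /= ?addr0 ?add0r.
Qed.

Lemma size_msupp_restr P u b : b \in msupp u -> ~ P b ->
  (size (msupp (restr P u)) < size (msupp u))%N.
Proof.
move=> bu Pb; apply: fproper_ltn_card.
rewrite fproperE; apply/andP; split.
  by apply/fsubsetP => b'; rewrite -!mcoeff_neq0 restrE; case: ifP; rewrite ?eqxx.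
apply/negP => /fsubsetP/(_ b bu); rewrite -mcoeff_neq0 restrE.
by case: asboolP => //; rewrite eqxx.
Qed.

(** The scalar [c] only certifies that [k] is nontrivial: over the zero ring every [mono k b] is
    0. *)
Lemma mono_inj (c : k) : c != 0 -> injective (@mono k B).
Proof.
move=> c0 b b' bb'; apply/eqP; apply: contraNT c0 => /negbTE bb'0.
have := mcoeff_mono b b'; rewrite bb' mcoeff_mono eqxx bb'0 => /= k0.
by rewrite -[c]mulr1 -[1]/(1%:R) k0 mulr0.
Qed.

End Restriction.

(** * E-congruence and projective classes of monomials *)

Section Congruence.
Variables (k : comPzRingType) (B : choiceType) (E : polygraph1 k B).
Implicit Types (u v w : freemod k B) (b : B) (P : set B).

Lemma E_congr_refl u : E_congr E u u.
Proof. by rewrite /E_congr subrr rpred0. Qed.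

Lemma E_congr_sym u v : E_congr E u v -> E_congr E v u.
Proof. by rewrite /E_congr -opprB rpredN. Qed.

Lemma E_congr_trans v u w : E_congr E u v -> E_congr E v w -> E_congr E u w.
Proof. by move=> uv vw; rewrite /E_congr -(subrKA v) rpredD. Qed.

Lemma E_congrD u u' v v' :
  E_congr E u u' -> E_congr E v v' -> E_congr E (u + v) (u' + v').
Proof. by move=> uu' vv'; rewrite /E_congr opprD addrACA rpredD. Qed.

Lemma E_congrZ c u v : E_congr E u v -> E_congr E (c *: u) (c *: v).
Proof. by move=> uv; rewrite /E_congr -scalerBr rpredZ. Qed.

Lemma proj_congr_refl b : proj_congr E b b.
Proof.
exists 1; first by exists 1; rewrite mulr1.
by rewrite scale1r; exact: E_congr_refl.
Qed.

Lemma proj_congr_sym b b' : proj_congr E b b' -> proj_congr E b' b.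
Proof.
move=> [c [d cd] bb']; exists d; first by exists c; rewrite mulrC.
have := E_congr_sym (E_congrZ d bb').
by rewrite scalerA [d * c]mulrC cd scale1r.
Qed.

Lemma proj_congr_trans b' b b'' :
  proj_congr E b b' -> proj_congr E b' b'' -> proj_congr E b b''.
Proof.
move=> [c [d cd] bb'] [c' [d' cd'] bb'']; exists (c * c').
  by exists (d * d'); rewrite mulrACA cd cd' mulr1.
by rewrite -scalerA; apply: E_congr_trans bb' (E_congrZ c bb'').
Qed.

Definition saturated P : Prop :=
  forall b b', proj_congr E b b' -> P b -> P b'.

Lemma saturated_class b : saturated (proj_congr E b).
Proof. by move=> b' b'' b'b'' bb'; exact: proj_congr_trans bb' b'b''. Qed.

(** Both ends of a relation of E are unit multiples of projectively congruent monomials, so a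
    saturated [P] contains both monomials or neither. *)
Lemma restr_relation P (e : rel1 E) b : monomial_invertible E -> saturated P ->
  src e = mono k b ->
  restr P (src e - tgt e) = if `[< P b >] then src e - tgt e else 0.
Proof.
move=> invE satP eb; have [_ [c [b' [c_unit eb']]]] := invE e.
have bb' : proj_congr E b b'.
  by exists c => //; apply: sub_lspan; exists e; rewrite // eb eb'.
have PP' : `[< P b >] = `[< P b' >].
  by apply: asbool_equiv_eq; split; apply: satP => //; exact: proj_congr_sym.
rewrite linearB eb eb' linearZ /= !restr_mono -PP'.
by case: ifP; rewrite // scaler0 subrr.
Qed.

Lemma restr_E_congr P u v : monomial_invertible E -> saturated P ->
  E_congr E u v -> E_congr E (restr P u) (restr P v).
Proof.
move=> invE satP; rewrite /E_congr -linearB /=.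
apply: (@lspan_image _ _ _ (restr P)) => _ [e _ <-].
have [[b eb] _] := invE e; rewrite /= (restr_relation invE satP eb).
by case: ifP => _; [apply: sub_lspan; exists e | exact: rpred0].
Qed.

Lemma E_congr_class b u : (forall b', b' \in msupp u -> proj_congr E b b') ->
  exists c, E_congr E u (c *: mono k b).
Proof.
move=> bu; have -> := f_equal (E_congr E) (freemod_sumE u).
(* The list of monomials is generalised for the induction, while the coefficients remain those of
   [u]. *)
have: {subset enum_fset (msupp u) <= [pred b' | `[< proj_congr E b b' >]]}.
  by move=> b' /bu/asboolP.
elim: (enum_fset (msupp u)) => [|b' s IHs] bs.
  by exists 0; rewrite big_nil scale0r; exact: E_congr_refl.
have [|c uc] := IHs; first by move=> b'' b''s; apply: bs; rewrite inE b''s orbT.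
have [|d _ b'b] := @proj_congr_sym b b' _; first by apply/asboolP/bs; rewrite inE eqxx.
exists (u@_b' * d + c); rewrite big_cons scalerDl -scalerA.
by apply: E_congrD uc; exact: E_congrZ.
Qed.

(** Over a nontrivial ring this is positivity in the context [v] of a rule with source [b], in a
    coordinatewise form that is visibly stable under linear combinations. *)
Definition avoids b v : Prop := forall b', proj_congr E b b' -> v@_b' = 0.

Lemma avoidsD b u v : avoids b u -> avoids b v -> avoids b (u + v).
Proof. by move=> bu bv b' bb'; rewrite mcoeffD bu// bv// addr0. Qed.

Lemma avoidsZ b c u : avoids b u -> avoids b (c *: u).
Proof. by move=> bu b' bb'; rewrite freemodZ bu// mulr0. Qed.

Lemma avoids_restr b u : avoids b (restr (~` proj_congr E b) u).
Proof. by move=> b' bb'; rewrite restrE; case: asboolP. Qed.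

(** Gathers the class of [b] into one coefficient, possibly 0; the remainder avoids [b], as a
    positive step at [b] demands. *)
Lemma E_congr_split b u :
  exists c, E_congr E u (c *: mono k b + restr (~` proj_congr E b) u).
Proof.
have [|c uc] := @E_congr_class b (restr (proj_congr E b) u).
  by move=> b'; rewrite -mcoeff_neq0 restrE; case: asboolP => //; rewrite eqxx.
exists c; rewrite {1}[u](restr_split (proj_congr E b)).
by apply: E_congrD uc _; exact: E_congr_refl.
Qed.

End Congruence.

(** * Positive steps and positive rewriting sequences *)

Section Rewriting.
Variables (k : comPzRingType) (B : choiceType) (S : lrsm k B).
Local Notation R := (lrsR S).
Local Notation E := (lrsE S).
Implicit Types (u v w : freemod k B) (b : B) (r : rel1 R).

Lemma positive_avoids r b v : src r = mono k b ->
  positive r v -> avoids E b v.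
Proof.
move=> rb pos b' bb'; apply/eqP; apply: contrapT => /negP.
rewrite mcoeff_neq0 => b'v; apply: pos; exists b => //.
by exists b'.
Qed.

Lemma avoids_positive (c : k) r b v : c != 0 -> src r = mono k b ->
  avoids E b v -> positive r v.
Proof.
move=> c0 rb bv [b1 [b2 + b1b2]]; rewrite rb => + /(mono_inj c0) b1b.
by rewrite b1b in b1b2; rewrite -mcoeff_neq0 bv// eqxx.
Qed.

Lemma avoids_tgt r b : src r = mono k b -> avoids E b (tgt r).
Proof. by move=> rb; apply: positive_avoids rb (proj2 (lrsR_adapted r)). Qed.

Lemma pos_step_congr u u' w w' : E_congr E u u' -> pos_step S u' w' ->
  E_congr E w' w -> pos_step S u w.
Proof.
move=> uu' [r [c [v [[c0 u'v vw'] pos]]]] w'w; exists r, c, v; split=> //.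
by split=> //; [exact: E_congr_trans uu' u'v | exact: E_congr_trans vw' w'w].
Qed.

Lemma pos_seq_congr u u' w : E_congr E u u' -> pos_seq S u' w -> pos_seq S u w.
Proof.
move=> uu' [u'w|]; first by left; exact: E_congr_trans u'w.
move=> h; right; elim: h u uu'.
  move=> x y xy u ux; apply: t_step; apply: pos_step_congr ux xy _.
  exact: E_congr_refl.
by move=> x y z _ IH yz _ u /IH uy; exact: t_trans uy yz.
Qed.

Lemma pos_seq_trans v u w : pos_seq S u v -> pos_seq S v w -> pos_seq S u w.
Proof.
move=> [uv|uv]; first exact: pos_seq_congr.
move=> [vw|vw]; right; last exact: t_trans uv vw.
elim: uv w vw => [x y xy w yw|x y z xy _ _ IH w /IH].
  by apply: t_step; apply: pos_step_congr xy yw; exact: E_congr_refl.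
by move=> yw; exact: t_trans xy yw.
Qed.

Lemma pos_seq_rule r b c v : src r = mono k b -> avoids E b v ->
  pos_seq S (c *: src r + v) (c *: tgt r + v).
Proof.
move=> rb bv; have [->|c0] := eqVneq c 0.
  by rewrite !scale0r; left; exact: E_congr_refl.
right; apply: t_step; exists r, c, v; split; last exact: avoids_positive c0 rb bv.
by split=> //; exact: E_congr_refl.
Qed.

Lemma rule_joinable r c v :
  exists2 w, pos_seq S (c *: src r + v) w & pos_seq S (c *: tgt r + v) w.
Proof.
have [b rb] := proj1 (lrsR_adapted r).
have [d vd] := E_congr_split E b v; rewrite -rb in vd.
set v' := restr _ v in vd; have bv' : avoids E b v' by exact: avoids_restr.
(* As [v] is congruent to [d *: src r + v'], the left vector has total coefficient [c + d] at
   [src r], all of which is rewritten at once. *)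
exists ((c + d) *: tgt r + v').
  apply: pos_seq_congr (pos_seq_rule _ rb bv').
  by rewrite scalerDl -addrA; apply: E_congrD vd; exact: E_congr_refl.
(* In the right vector only [d *: src r] remains to be rewritten; the context is still avoiding
   because R is E-adapted. *)
have btv' : avoids E b (c *: tgt r + v').
  by apply: avoidsD bv'; apply: avoidsZ; exact: avoids_tgt.
rewrite [c + d]addrC scalerDl -addrA.
apply: pos_seq_congr (pos_seq_rule _ rb btv').
by rewrite addrCA; apply: E_congrD vd; exact: E_congr_refl.
Qed.

Lemma pos_seq_presented u w : pos_seq S u w ->
  presented_pi S u = presented_pi S w.
Proof.
have subE u' w' : E_congr E u' w' -> presented_pi S u' = presented_pi S w'.
  move=> uw; apply/quot_piP; apply: (@lspan_image _ _ _ idfun) uw => _ [e _ <-].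
  by apply: sub_lspan; exists (inr e).
have step u' w' : pos_step S u' w' -> presented_pi S u' = presented_pi S w'.
  move=> [r [c [v [[_ /subE-> /subE<-] _]]]]; apply/quot_piP.
  rewrite opprD addrACA subrr addr0 -scalerBr rpredZ//.
  by apply: sub_lspan; exists (inl r).
move=> [/subE//|]; elim=> [x y /step//|x y z _ -> _ ->//].
Qed.

Lemma BNF_saturated : saturated E (BNF S).
Proof.
move=> b b' bb' bN r b'' rb'' b'b''.
by apply: (bN r b'' rb''); exact: proj_congr_trans bb' b'b''.
Qed.

Lemma nfpredP u : reflect (forall b, ~ BNF S b -> u@_b = 0) (u \in nfpred S).
Proof.
apply: (iffP (asboolP _)) => uN b; last first.
  by rewrite -mcoeff_neq0 => ub; apply: contrapT => /uN/eqP; exact/negP.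
by move=> bN; apply/eqP; apply: contrapT => /negP; rewrite mcoeff_neq0 => /uN.
Qed.

(** * Termination: irreducibility and existence of normal forms *)

Section Terminating.
Hypothesis S_term : pos_terminating S.

(* If [c *: src r] is E-congruent to 0, then 0 rewrites to [c *: tgt r], and
   adding [c *: src r] again and again yields an infinite sequence. *)
Lemma src_torsion_free r c : E_congr E (c *: src r) 0 -> c = 0.
Proof.
move=> cr0; apply/eqP; apply: contrapT => /negP c0; apply: S_term.
have [b rb] := proj1 (lrsR_adapted r).
exists (fun n => (c *+ n) *: tgt r) => n.
exists r, c, ((c *+ n) *: tgt r); split; last first.
  by apply: (avoids_positive c0 rb); apply: avoidsZ; exact: avoids_tgt.
split=> //.
  rewrite -[X in E_congr E X]add0r; apply: E_congrD; last exact: E_congr_refl.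
  exact: E_congr_sym.
by rewrite mulrS scalerDl; exact: E_congr_refl.
Qed.

Lemma nf_irreducible u w : u \in nfpred S -> ~ pos_step S u w.
Proof.
move=> /nfpredP uN [r [c [v [[c0 uv _] pos]]]].
have [b rb] := proj1 (lrsR_adapted r).
have bv := positive_avoids rb pos.
(* Restriction to the class of [b] kills [v] by positivity, and kills [u] because no monomial of
   this class is in [BNF S]. Only [c *: mono k b] survives, congruent to 0. *)
have := restr_E_congr (@lrsE_invertible _ _ S) (@saturated_class _ _ E b) uv.
rewrite linearD linearZ /= rb restr_mono asboolT; last exact: proj_congr_refl.
rewrite (restr_eq0 bv) addr0 restr_eq0 => [|b' bb'].
  by rewrite -rb => /E_congr_sym/src_torsion_free/eqP; exact/negP.
by apply: uN => /(_ r b rb); apply; exact: proj_congr_sym.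
Qed.

Lemma nf_pos_seq u w : u \in nfpred S -> pos_seq S u w -> E_congr E u w.
Proof.
have irred x y : clos_trans _ (pos_step S) x y -> ~ x \in nfpred S.
  by elim=> [x' y' xy /nf_irreducible/(_ xy)|].
by move=> uN [|/irred].
Qed.

(** A counterexample always steps to another counterexample; dependent choice chains them into an
    infinite sequence. *)
Lemma pos_step_ind (P : freemod k B -> Prop) :
  (forall u, (forall w, pos_step S u w -> P w) -> P u) -> forall u, P u.
Proof.
move=> IH u; apply: contrapT => Pu; apply: S_term.
have next (x : {v | ~ P v}) : {y : {v | ~ P v} | pos_step S (sval x) (sval y)}.
  apply: cid; case: x => x Px /=; apply: contrapT => none; apply/Px/IH => w xw.
  by apply: contrapT => Pw; apply: none; exists (exist _ w Pw).
have [f [_ fS]] := dependent_choice next (exist _ u Pu).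
by exists (sval \o f).
Qed.

(** A vector outside NF need not admit the expected step: the monomials in the class of a source may
    cancel modulo E. The vector is then congruent to one with smaller support, hence an inner
    induction on the support size inside the induction on steps. *)
Lemma nf_exists u : exists2 w, w \in nfpred S & pos_seq S u w.
Proof.
elim/pos_step_ind: u => u.
have [n] := ubnP (size (msupp u)); elim: n u => // n IHn u /ltnSE un IHu.
have [uN|] := boolP (u \in nfpred S).
  by exists u => //; left; exact: E_congr_refl.
move=> /asboolPn/existsNP[b /not_implyP[bu /existsNP[r /existsNP[b']]]].
move=> /not_implyP[rb' /contrapT bb'].
have [c uc] := E_congr_split E b' u; set v := restr _ u in uc.
have [c0|c0] := eqVneq c 0.
  rewrite c0 scale0r add0r in uc.
  have [||w wN vw] := IHn v; last by exists w => //; exact: pos_seq_congr uc vw.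
    apply: leq_trans un; apply: size_msupp_restr bu _; apply.
    exact: proj_congr_sym.
  (* Any step from [v] is also a step from the congruent [u], so the outer hypothesis passes to
     [v]. *)
  move=> w vw; apply: IHu; apply: pos_step_congr uc vw _; exact: E_congr_refl.
have uv : pos_step S u (c *: tgt r + v).
  exists r, c, v; split; last first.
    by apply: (avoids_positive c0 rb'); exact: avoids_restr.
  by split; rewrite ?rb' //; exact: E_congr_refl.
have [w wN vw] := IHu _ uv; exists w => //.
by apply: pos_seq_trans vw; right; exact: t_step.
Qed.

End Terminating.

(** * The linear retraction onto the module of normal forms *)

Fact nf_proj_subproof u : restr (BNF S) u \in nfpred S.
Proof. by apply/nfpredP => b bN; rewrite restrE; case: asboolP. Qed.

Definition nf_proj u : NF S := MkNF (nf_proj_subproof u).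

Fact nf_proj_is_linear : linear nf_proj.
Proof. by move=> c u v; apply: val_inj; rewrite /= !linearP. Qed.

HB.instance Definition _ := GRing.isLinear.Build k (freemod k B) (NF S) *:%R
  nf_proj nf_proj_is_linear.

Lemma nf_projK (u : NF S) : nf_proj (val u) = u.
Proof. by apply: val_inj; rewrite /= restr_id//; apply/nfpredP; exact: valP. Qed.

(** The retraction [nf_proj] fixes both vectors and sends each relation of E either to itself,
    inside NF, or to 0, since [BNF S] is saturated. *)
Lemma nf_pi_eq (u w : NF S) : E_congr E (val u) (val w) -> nf_pi u = nf_pi w.
Proof.
move=> uw; apply/quot_piP; rewrite -[u]nf_projK -[w]nf_projK -linearB.
apply: (@lspan_image _ _ _ nf_proj) uw => _ [e _ <-].
have [[b eb] _] := lrsE_invertible e.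
have := restr_relation (@lrsE_invertible _ _ S) BNF_saturated eb.
case: asboolP => bN eE; last first.
  by rewrite [X in X \in _](_ : _ = 0) ?rpred0//; exact: val_inj.
by apply: sub_lspan; exists e => //; exists b.
Qed.

(** * Convergence: uniqueness of normal forms and bijectivity *)

Section Convergent.
Hypothesis S_conv : pos_convergent S.
Let S_term := proj2 S_conv.

(** Confluence joins [w] and [w'], and vectors of NF move only within their E-class. *)
Lemma nf_unique u v w w' : pos_seq S u v -> w \in nfpred S ->
  w' \in nfpred S -> pos_seq S u w -> pos_seq S v w' -> E_congr E w w'.
Proof.
move=> uv wN w'N uw vw'.
have [z wz w'z] := proj1 S_conv u w w' uw (pos_seq_trans uv vw').
apply: E_congr_trans (nf_pos_seq S_term wN wz) _.
by apply: E_congr_sym; exact: nf_pos_seq w'z.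
Qed.

(** Normal forms are determined only up to E, so all of them are compared; their existence makes the
    relation transitive. *)
Definition same_nf u v : Prop := forall w w', w \in nfpred S ->
  w' \in nfpred S -> pos_seq S u w -> pos_seq S v w' -> E_congr E w w'.

Lemma same_nf_trans v u w : same_nf u v -> same_nf v w -> same_nf u w.
Proof.
move=> uv vw u' w' u'N w'N uu' ww'; have [v' v'N vv'] := nf_exists S_term v.
exact: E_congr_trans (uv _ _ u'N v'N uu' vv') (vw _ _ v'N w'N vv' ww').
Qed.

Lemma same_nf_joinable u v z : pos_seq S u z -> pos_seq S v z -> same_nf u v.
Proof.
move=> uz vz w w' wN w'N uw vw'; have [z' z'N zz'] := nf_exists S_term z.
apply: E_congr_trans (nf_unique uz wN z'N uw zz') _.
by apply: E_congr_sym; exact: nf_unique vz w'N z'N vw' zz'.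
Qed.

Lemma same_nf_span u v : u - v \in lspan (relset (polygraph1_sum R E)) ->
  same_nf u v.
Proof.
move=> /asboolP[n [c [a [aA /(canRL (subrK v)) ->]]]].
elim: n c a aA v => [|n IHn] c a aA v.
  rewrite big_ord0 add0r; apply: (@same_nf_joinable _ _ v); left;
    exact: E_congr_refl.
rewrite big_ord_recl -addrA addrCA.
apply: same_nf_trans (IHn _ _ (fun i => aA (lift ord0 i)) _) _.
have [[r|e] _ <- /=] := aA ord0.
  rewrite scalerBr -addrA [- _ + v]addrC.
  (* With this context the target end is [v] itself. The context may meet the class of the source,
     so the rule need not be a positive step and only joinability is available. *)
  have [w] := rule_joinable r (c ord0) (v - c ord0 *: tgt r).
  rewrite [_ *: tgt r + _]addrC subrK => uw vw.
  exact: same_nf_joinable uw vw.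
apply: (@same_nf_joinable _ _ v); left; last exact: E_congr_refl.
by rewrite /E_congr addrK rpredZ//; apply: sub_lspan; exists e.
Qed.

Lemma nf_canon_inj : injective (@nf_canon k B S).
Proof.
move=> x y; rewrite -[x]quot_piK -[y]quot_piK !nf_canon_pi => /quot_piP xy.
(* Vectors of NF are their own normal forms, through the trivial congruence. *)
apply: nf_pi_eq; apply: (same_nf_span xy); try exact: valP;
  left; exact: E_congr_refl.
Qed.

Lemma nf_canon_surj (y : presented S) : exists x, nf_canon x = y.
Proof.
rewrite -[y]quot_piK; have [w wN uw] := nf_exists S_term (repr y).
by exists (nf_pi (MkNF wN)); rewrite nf_canon_pi /= -(pos_seq_presented uw).
Qed.

Lemma nf_canon_bij : bijective (@nf_canon k B S).
Proof.
have [g gK] := choice nf_canon_surj.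
by exists g => // x; apply: nf_canon_inj; rewrite gK.
Qed.

End Convergent.
End Rewriting.

Theorem mainTheorem3 (k : comPzRingType) (B : choiceType) (S : lrsm k B)
    (S_conv : pos_convergent S) :
  bijective (@nf_canon k B S : {linear NFmodE S -> presented S}) /\
  forall X : set B, X `<=` BNF S ->
    is_basis [set nf_pi u | u in [set u : NF S | (@mono k B @` X) (val u)]] ->
    is_basis [set presented_pi S (mono k b) | b in X].
Proof.
split=> [|X XN Xbasis]; first exact: nf_canon_bij.
have := is_basis_image (f := @nf_canon k B S) (nf_canon_bij S_conv) Xbasis.
congr is_basis; apply/seteqP; split.
  by move=> _ [_ [u [b Xb bu] <-] <-]; exists b; rewrite //= nf_canon_pi -bu.
move=> _ [b Xb <-].
have bN : mono k b \in nfpred S.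
  apply/nfpredP => b' b'N; rewrite mcoeff_mono; case: eqP => // bb'.
  by case: b'N; rewrite -bb'; exact: XN.
exists (nf_pi (MkNF bN)); last by rewrite /= nf_canon_pi.
by exists (MkNF bN) => //; exists b.
Qed.
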